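(* Let $\Delta$ be an integer with $\Delta\ge 27$. If $n\ge \frac{\Delta}{\log\Delta}$ is an integer, then \[ f(n,\Delta)\le 8\cdot\frac{\log\Delta}{\Delta}\,n. \]
   Context: An $n\times n$ bipartite graph is a bipartite graph $G=(A\cup B,E)$ with a fixed bipartition into parts $A,B$ with $|A|=|B|=n$. A bi-hole of size $k$ in such a graph is a pair $(X,Y)$ with $X\subseteq A$, $Y\subseteq B$, $|X|=|Y|=k$, such that no edge of $G$ joins a vertex of $X$ to a vertex of $Y$. $f(n,\Delta)$ is the largest integer $k$ such that every $n\times n$ bipartite graph $G=(A\cup B,E)$ with $\deg(a)\le\Delta$ for all $a\in A$ contains a bi-hole of size $k$. $\log$ denotes the natural logarithm. *)

(* Defs.v *)
From mathcomp Require Import all_boot.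

Set Implicit Arguments.
Unset Strict Implicit.
Unset Printing Implicit Defensive.

(* A bipartite graph with ordered parts A and B is its edge set
   E : {set A * B}. *)

Definition degl (A B : finType) (E : {set A * B}) (a : A) : nat :=
  #|[set b : B | (a, b) \in E]|.

Definition bihole (A B : finType) (E : {set A * B}) (k : nat)
    (X : {set A}) (Y : {set B}) : bool :=
  [&& #|X| == k, #|Y| == k
    & [forall x in X, forall y in Y, (x, y) \notin E]].

Definition has_bihole (A B : finType) (E : {set A * B}) (k : nat) : bool :=
  [exists X : {set A}, exists Y : {set B}, bihole E k X Y].

(* Every n x n bipartite graph is isomorphic to one whose parts are two
   copies of 'I_n, so quantifying over these loses nothing. *)
Definition forces_bihole (n Delta k : nat) : bool :=
  [forall E : {set 'I_n * 'I_n},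
     [forall a, degl E a <= Delta] ==> has_bihole E k].

(* The bound k < n.+1 only makes the range finite: see f_max. *)
Definition f (n Delta : nat) : nat :=
  \max_(k < n.+1 | forces_bihole n Delta k) k.

Lemma forces_bihole0 n Delta : forces_bihole n Delta 0.
Proof.
apply/forallP => E; apply/implyP => _.
apply/existsP; exists set0; apply/existsP; exists set0.
rewrite /bihole !cards0 /=.
by apply/forall_inP => x; rewrite in_set0.
Qed.

Lemma forces_bihole_le n Delta k : forces_bihole n Delta k -> k <= n.
Proof.
move/forallP/(_ set0)/implyP => H.
have /H /existsP[X /existsP[Y /and3P[/eqP <- _ _]]] :
    [forall a, degl (set0 : {set 'I_n * 'I_n}) a <= Delta].
  apply/forallP => a; rewrite /degl (_ : [set b | _] = set0) ?cards0 //.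
  by apply/setP => b; rewrite !inE.
by rewrite -[leqRHS]card_ord max_card.
Qed.

Lemma f_forces n Delta : forces_bihole n Delta (f n Delta).
Proof.
rewrite /f (bigmax_eq_arg (ord0 : 'I_n.+1)) ?forces_bihole0 //.
by case: arg_maxnP => //; exact: forces_bihole0.
Qed.

Lemma f_max n Delta k : forces_bihole n Delta k -> k <= f n Delta.
Proof.
move=> Hk; have kn : k < n.+1 by rewrite ltnS (forces_bihole_le Hk).
exact: (leq_bigmax_cond (Ordinal kn)).
Qed.

(* Main.v *)
Require Import Defs.
From mathcomp Require Import all_boot all_order all_algebra.
From mathcomp Require Import all_classical all_reals all_analysis.
From mathcomp Require Import ring lra.

(** Let every vertex of [A] choose [Delta] neighbours in [B] independently and
    uniformly, with repetition, so that all left degrees are at most [Delta].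
    A fixed pair of [k]-sets is a bi-hole with probability
    [(1 - k/n)^(k Delta)], so by the union bound a graph without bi-hole of
    size [k] exists as soon as [C(n,k)^2 (1 - k/n)^(k Delta) < 1].  Since
    [C(n,k) <= (e n/k)^k], it is enough that [(e n/k)^2 exp(-t) < 1] where
    [t = Delta k/n].  If [t > 8 ln Delta], then [t > 4], hence
    [e n/k = exp(1 + ln Delta)/t < exp(t/2)]. *)

Import Order.TTheory GRing.Theory Num.Theory.
Local Open Scope ring_scope.

Lemma cardsC_sub (T : finType) (S : {set T}) : #|~: S| = (#|T| - #|S|)%N.
Proof. by rewrite cardsCs finset.setCK. Qed.

Section RandomChoices.
Context {A B I : finType}.
Implicit Types (g : {ffun A * I -> B}) (X : {set A}) (Y : {set B}).

(** [g (a, i)] is the [i]-th choice of [a]; counting over all [g] stands in for probability. *)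
Definition choice_graph g : {set A * B} :=
  [set p | [exists i, g (p.1, i) == p.2]].

Lemma degl_choice_graph g a : (degl (choice_graph g) a <= #|I|)%N.
Proof.
rewrite /degl; apply: leq_trans (leq_imset_card (fun i => g (a, i)) predT).
apply/subset_leq_card/fintype.subsetP => b; rewrite !inE => /existsP[i /eqP /= <-].
exact: imset_f.
Qed.

(** Avoidance restricts each value of [g] separately: at a coordinate [(x, i)] with [x] in [X] it
    must lie outside [Y], elsewhere it is free. Hence the count is a product over coordinates. *)
Lemma card_choices_avoiding X Y :
  #|[set g | [forall x in X, forall y in Y, (x, y) \notin choice_graph g]]| =
  (#|B| ^ ((#|A| - #|X|) * #|I|) * (#|B| - #|Y|) ^ (#|X| * #|I|))%N.
Proof.
pose F (p : A * I) : {pred B} := [pred b | (p.1 \in X) ==> (b \notin Y)].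
have -> : #|[set g | [forall x in X, forall y in Y,
                        (x, y) \notin choice_graph g]]| = #|family F|.
  apply: eq_card => g; rewrite inE; apply/idP/familyP => [H [x i]|H].
    rewrite inE /=; apply/implyP => xX; apply/negP => gY.
    move/forall_inP: H => /(_ x xX)/forall_inP/(_ _ gY).
    by rewrite inE /= => /existsPn/(_ i); rewrite eqxx.
  apply/forall_inP => x xX; apply/forall_inP => y yY.
  rewrite inE; apply/existsPn => i /=; apply/negP => /eqP gy.
  by have := H (x, i); rewrite inE /= xX gy yY.
rewrite card_family foldrE big_map big_enum /=.
rewrite (bigID (fun p : A * I => p.1 \in X)) /= mulnC; congr (_ * _)%N.
  rewrite (eq_bigr (fun=> #|B|)) => [|p /negbTE pX]; last first.
    by apply: eq_card => b; rewrite !inE pX.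
  rewrite prod_nat_const; congr (_ ^ _)%N.
  rewrite -[in RHS]cardsC_sub -[#|I|]cardsT -cardsX; apply: eq_card => -[x i].
  by rewrite !inE andbT.
rewrite (eq_bigr (fun=> (#|B| - #|Y|)%N)) => [|p pX]; last first.
  by rewrite -cardsC_sub; apply: eq_card => b; rewrite !inE pX.
rewrite prod_nat_const; congr (_ ^ _)%N.
rewrite -[#|I|]cardsT -cardsX; apply: eq_card => -[x i].
by rewrite !inE andbT.
Qed.

End RandomChoices.

(** The union bound as a count: every [g] is bad for at least one pair of [k]-sets, so the sets
    [bad p] cover all choice functions. *)
Lemma forces_bihole_union_bound n Delta k : (0 < n)%N ->
  forces_bihole n Delta k ->
  (n ^ (k * Delta) <= 'C(n, k) ^ 2 * (n - k) ^ (k * Delta))%N.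
Proof.
move=> n0 Hf; have kn := forces_bihole_le Hf.
pose T := {ffun 'I_n * 'I_Delta -> 'I_n}.
pose P := [set p : {set 'I_n} * {set 'I_n} | (#|p.1| == k) && (#|p.2| == k)].
pose bad (p : {set 'I_n} * {set 'I_n}) : {set T} :=
  [set g | [forall x in p.1, forall y in p.2, (x, y) \notin choice_graph g]].
have cover g : (1 <= \sum_(p in P) (g \in bad p))%N.
  have deg : [forall a, degl (choice_graph g) a <= Delta]%N.
    by apply/forallP => a; rewrite -[leqRHS]card_ord degl_choice_graph.
  move/forallP: Hf => /(_ (choice_graph g))/implyP/(_ deg).
  move=> /existsP[X /existsP[Y /and3P[cX cY H]]].
  rewrite (bigD1 (X, Y)) ?inE ?cX //=.
  by rewrite H.
have cardP : #|P| = ('C(n, k) ^ 2)%N.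
  have := card_draws 'I_n k; rewrite card_ord => cD.
  rewrite expnS expn1 -{1}cD -cD -cardsX; apply: eq_card => -[X Y].
  by rewrite !inE.
have : (#|T| <= \sum_(p in P) #|bad p|)%N.
  rewrite -sum1_card; under [leqRHS]eq_bigr do rewrite -sum1_card.
  apply: leq_trans (leq_sum _ (fun g _ => cover g)) _.
  rewrite exchange_big /=; apply: leq_sum => p _.
  by rewrite [leqRHS]big_mkcond; apply: leq_sum => g _; case: (g \in _).
rewrite (eq_bigr (fun=> n ^ ((n - k) * Delta) * (n - k) ^ (k * Delta))%N); last first.
  move=> [X Y]; rewrite inE /= => /andP[/eqP cX /eqP cY].
  by rewrite card_choices_avoiding cX cY !card_ord.
rewrite sum_nat_const cardP card_ffun card_prod !card_ord.
(* Splitting [n] as [(n - k) + k] in the exponent of [#|T|] lets the factor of the free coordinates,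
   [n ^ ((n - k) * Delta)], cancel. *)
rewrite -[X in (_ ^ (X * _) <= _)%N](subnK kn) mulnDl expnD mulnCA leq_pmul2l //.
by rewrite expn_gt0 n0.
Qed.

Section Estimates.
Variable R : realType.

(** A weak Stirling bound: passing from [k] to [k.+1] multiplies [k ^ k / k!] by [(1 + 1/k) ^ k],
    which is at most [e]. *)
Lemma expnn_le_fact k : (k ^ k)%:R <= expR k%:R * k`!%:R :> R.
Proof.
elim: k => [|k IH]; first by rewrite expR0 mul1r.
have step : (k.+1 ^ k)%:R <= expR 1 * (k ^ k)%:R :> R.
  (* The case [k = 0] is apart because [1/k] is used below; there [0 ^ 0 = 1] and the claim is
     [1 <= e]. *)
  case: k {IH} => [|k].
    by rewrite !expn0 mulr1; apply: le_trans (expR_ge1Dx _); lra.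
  have k0 : 0 < k.+1%:R :> R by rewrite ltr0n.
  have -> : expR 1 = expR (k.+1%:R^-1) ^+ k.+1 :> R.
    by rewrite -expRM_natl mulfV ?gt_eqF.
  rewrite !natrX -exprMn lerXn2r ?nnegrE ?mulr_ge0 ?expR_ge0 ?ler0n //.
  rewrite -ler_pdivrMr // -[k.+2]addn1 natrD mulrDl mulfV ?gt_eqF // mul1r.
  exact: expR_ge1Dx.
rewrite expnS factS !natrM [in expR _]mulrSr expRD.
apply: le_trans (ler_wpM2l (ler0n R k.+1) step) _.
rewrite mulrCA [leRHS](_ : _ = expR 1 * (k.+1%:R * (expR k%:R * k`!%:R))).
  by rewrite !ler_wpM2l ?expR_ge0.
by ring.
Qed.

(** The falling factorial ['C(n, k) * k!] is at most [n ^ k], while [k!] is at least [(k/e) ^ k]. *)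
Lemma bin_le_expR n k : (0 < k)%N ->
  'C(n, k)%:R <= (expR 1 * n%:R / k%:R) ^+ k :> R.
Proof.
move=> k0; have kR : 0 < k%:R :> R by rewrite ltr0n.
have fR : 0 < k`!%:R :> R by rewrite ltr0n fact_gt0.
have ffact_le : (n ^_ k <= n ^ k)%N.
  rewrite ffact_prod -[X in (_ <= _ ^ X)%N]card_ord -prod_nat_const.
  by apply: leq_prod => i _; rewrite leq_subr.
rewrite expr_div_n ler_pdivlMr ?exprn_gt0 // exprMn -expRM_natl mulr1 -!natrX.
apply: le_trans (ler_wpM2l (ler0n _ _) (expnn_le_fact k)) _.
rewrite mulrCA -natrM bin_ffact.
by rewrite ler_wpM2l ?expR_ge0 // ler_nat.
Qed.

(** The hypothesis is the square root of [(e n/k)^2 < exp(t)], [t = Delta k/n]. Both sides are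
    compared through [k]-th powers, so it suffices to compare bases; [k > 0] keeps this strict. *)
Lemma union_bound_lt (n Delta k : nat) :
  (0 < n)%N -> (0 < k)%N -> (k <= n)%N ->
  expR 1 * n%:R / k%:R < expR (Delta%:R * k%:R / (2 * n%:R)) :> R ->
  ('C(n, k) ^ 2 * (n - k) ^ (k * Delta) < n ^ (k * Delta))%N.
Proof.
move=> n0 k0 kn H; have nR : 0 < n%:R :> R by rewrite ltr0n.
rewrite -(ltr_nat R) natrM !natrX natrB //.
have kR : 0 < k%:R :> R by rewrite ltr0n.
(* This rests on [1 - k/n <= exp(-k/n)]. *)
have hole : (n%:R - k%:R) ^+ (k * Delta) <=
    (expR (- (Delta%:R * k%:R / n%:R)) * n%:R ^+ Delta) ^+ k :> R.
  rewrite mulnC exprM lerXn2r ?nnegrE ?mulr_ge0 ?expR_ge0 ?exprn_ge0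
    ?subr_ge0 ?ler_nat //.
  rewrite -mulrA -mulrN expRM_natl -exprMn lerXn2r ?nnegrE ?mulr_ge0 ?expR_ge0
    ?subr_ge0 ?ler_nat //.
  rewrite -ler_pdivrMr // mulrBl mulfV ?gt_eqF //.
  exact: expR_ge1Dx.
have lt1 : (expR 1 * n%:R / k%:R) ^+ 2 * expR (- (Delta%:R * k%:R / n%:R)) < 1 :> R.
  rewrite expRN -ltr_pdivlMr ?invr_gt0 ?expR_gt0 // invrK mul1r.
  have -> : Delta%:R * k%:R / n%:R = 2%:R * (Delta%:R * k%:R / (2 * n%:R)) :> R.
    by field; rewrite gt_eqF.
  by rewrite expRM_natl ltrXn2r ?nnegrE ?divr_ge0 ?mulr_ge0 ?expR_ge0.
have bin2 : 'C(n, k)%:R ^+ 2 <= ((expR 1 * n%:R / k%:R) ^+ 2) ^+ k :> R.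
  rewrite exprAC lerXn2r ?nnegrE ?exprn_ge0 ?divr_ge0 ?mulr_ge0 ?expR_ge0 //.
  exact: bin_le_expR.
apply: le_lt_trans (ler_pM _ _ bin2 hole) _.
- by rewrite exprn_ge0.
- by rewrite exprn_ge0 // subr_ge0 ler_nat.
rewrite -exprMn [(k * _)%N]mulnC exprM ltrXn2r ?nnegrE //.
- by rewrite -lt0n.
- by rewrite mulrA gtr_pMl ?exprn_gt0.
Qed.

(** Taking [y = - ln x] in [1 + y <= exp y] gives [ln x >= 1 - 1/x]. *)
Lemma ln_ge_half (x : R) : 2 <= x -> 1 / 2 <= ln x.
Proof.
move=> x2; have x0 : 0 < x by lra.
have := expR_ge1Dx (- ln x); rewrite -lnV ?posrE // lnK ?posrE ?invr_gt0 //.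
rewrite lnV ?posrE //.
have : x^-1 <= 2^-1 by rewrite lef_pV2 ?posrE.
lra.
Qed.

Lemma bin_base_lt (D x : R) : 2 <= D -> 8 * ln D / D < x ->
  expR 1 / x < expR (D * x / 2).
Proof.
move=> D2 hx; have D0 : 0 < D by lra.
have hL := ln_ge_half _ D2.
have ht : 8 * ln D < D * x by rewrite [ltRHS]mulrC -ltr_pdivrMr.
have t0 : 0 < D * x by lra.
have x0 : 0 < x by rewrite -(pmulr_rgt0 _ D0).
have -> : expR 1 / x = expR (1 + ln D) / (D * x).
  by rewrite expRD lnK ?posrE //; field; rewrite !gt_eqF.
rewrite ltr_pdivrMr //; apply: (@lt_le_trans _ _ (expR (D * x / 2))).
  (* Since [ln D >= 1/2], one has [1 + ln D < 4 ln D < D x / 2]. *)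
  by rewrite ltr_expR; lra.
(* The extra factor [D * x] exceeds 4, so it only enlarges the right side. *)
by rewrite ler_peMr ?expR_ge0 //; lra.
Qed.

End Estimates.

Theorem theorem1p2 (R : realType) (Delta n : nat)
    (hDelta : (27 <= Delta)%N)
    (hn : Delta%:R / ln (Delta%:R : R) <= n%:R) :
  (f n Delta)%:R <= 8 * (ln (Delta%:R : R) / Delta%:R) * n%:R.
Proof.
rewrite leNgt; apply/negP => hk.
have D2 : 2 <= Delta%:R :> R by rewrite ler_nat (leq_trans _ hDelta).
have kn := forces_bihole_le (f_forces n Delta).
(* Exceeding a nonnegative bound makes [f n Delta] positive, and then [n] as well, so the ratio
   [k/n] can be used with [k = f n Delta]. *)
have k0 : (0 < f n Delta)%N.
  rewrite -(ltr0n R); apply: le_lt_trans hk; rewrite !mulr_ge0 ?invr_ge0 //.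
  by have := ln_ge_half _ _ D2; lra.
have n0 : (0 < n)%N by apply: leq_trans kn.
have nR : 0 < n%:R :> R by rewrite ltr0n.
have kR : 0 < (f n Delta)%:R :> R by rewrite ltr0n.
have base : expR 1 / ((f n Delta)%:R / n%:R) <
    expR (Delta%:R * ((f n Delta)%:R / n%:R) / 2) :> R.
  by apply: bin_base_lt => //; rewrite ltr_pdivlMr // -mulrA.
have := forces_bihole_union_bound _ _ _ n0 (f_forces n Delta).
rewrite leqNgt => /negP; apply; apply: (union_bound_lt R) => //.
have -> : expR 1 * n%:R / (f n Delta)%:R =
    expR 1 / ((f n Delta)%:R / n%:R) :> R by rewrite invf_div mulrA.
have -> : Delta%:R * (f n Delta)%:R / (2 * n%:R) =
    Delta%:R * ((f n Delta)%:R / n%:R) / 2 :> R by rewrite invfM; ring.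
exact: base.
Qed.
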